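(* There is a positive constant $C$ such that the following holds. For each $n$ let $A_n$ be the $n\times n$ matrix of one fixed type among circulant ($C_n$), symmetric circulant ($SC_n$), reverse circulant ($RC_n$) and Hankel ($H_n$), built from a Gaussian input sequence $\{X_j: j\ge 0\}$. Then $$\limsup_{n\to\infty}\frac{\|A_n\|}{\sqrt{n\log n}}\le C\quad\text{almost surely},$$ where $\|\cdot\|$ denotes the spectral norm.
   Context: A Gaussian input sequence $\{X_j: j\ge 0\}$ is a sequence of i.i.d. standard normal random variables. For $1\le i,j\le n$, the $(i,j)$-th entries are: $C_n$: $X_{(j-i)\bmod n}$ (residues in $\{0,\dots,n-1\}$); $SC_n$: $X_{\frac n2-\left|\frac n2-|i-j|\right|}$, i.e. $X_{\min(|i-j|,\,n-|i-j|)}$; $RC_n$: $X_{(i+j-1)\bmod n}$ (residues in $\{1,\dots,n\}$); $H_n$: $X_{i+j-1}$. The spectral norm is the operator norm with respect to the Euclidean norm. *)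

(* Defs.v *)
From HB Require Import structures.
From mathcomp Require Import all_boot all_order all_algebra.
From mathcomp Require Import finmap.
From mathcomp Require Import all_classical all_reals all_analysis.
Import Order.TTheory GRing.Theory Num.Theory.
Import numFieldNormedType.Exports.

Set Implicit Arguments.
Unset Strict Implicit.
Unset Printing Implicit Defensive.

Local Open Scope classical_set_scope.
Local Open Scope ring_scope.

Definition mutually_independent (I : choiceType) (d d' : measure_display)
    (T : measurableType d) (T' : measurableType d') (R : realType)
    (P : probability T R) (X : I -> {RV P >-> T'}) : Prop :=
  forall (J : {fset I}) (B : I -> set T'),
    (forall i, measurable (B i)) ->
    P (\bigcap_(i in [set` J]) (X i @^-1` B i)) =
      (\prod_(i <- J) P (X i @^-1` B i))%E.

Definition standard_normal (d : measure_display) (T : measurableType d)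
    (R : realType) (P : probability T R) (Y : {RV P >-> R}) : Prop :=
  forall B : set R, measurable B -> distribution P Y B = normal_prob 0 1 B.

Definition gaussian_input (d : measure_display) (T : measurableType d)
    (R : realType) (P : probability T R) (X : nat -> {RV P >-> R}) : Prop :=
  mutually_independent X /\ forall j, standard_normal (X j).

Variant pattern := Circulant | SymCirculant | RevCirculant | Hankel.

(* Index of the input variable at the 1-based position (i, j) of the n x n
   matrix, 1 <= i, j <= n. In RevCirculant the residues are taken in
   {1, ..., n}, so that residue 0 is read as n. *)
Definition link (p : pattern) (n i j : nat) : nat :=
  match p with
  | Circulant => `|((j%:Z - i%:Z) %% n%:Z)%Z|
  | SymCirculant => minn `|i%:Z - j%:Z| (n - `|i%:Z - j%:Z|)
  | RevCirculant =>
      if ((i + j - 1) %% n == 0)%N then n else ((i + j - 1) %% n)%N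
  | Hankel => (i + j - 1)%N
  end.

(* Row and column ordinals are 0-based, hence the successors. *)
Definition patterned_mx (R : Type) (p : pattern) (x : nat -> R) (n : nat) :
    'M[R]_n :=
  \matrix_(i < n, j < n) x (link p n i.+1 j.+1).

(* The norm that MathComp-Analysis puts on matrices is the max norm. *)
Definition euclidean_norm (R : realType) (n : nat) (v : 'cV[R]_n) : R :=
  Num.sqrt (\sum_(i < n) v i ord0 ^+ 2).

Definition spectral_norm (R : realType) (m n : nat) (A : 'M[R]_(m, n)) : R :=
  sup [set euclidean_norm (A *m v) | v in [set v | euclidean_norm v <= 1]].

(* Main.v *)
From HB Require Import structures.
Require Import Defs.
From mathcomp Require Import all_boot all_order all_algebra.
From mathcomp Require Import finmap.
From mathcomp Require Import all_classical all_reals all_analysis.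
From mathcomp Require Import measurable_realfun.
From mathcomp Require Import zify ring lra.
Import Order.TTheory GRing.Theory Num.Theory.
Import numFieldNormedType.Exports.

Set Implicit Arguments.
Unset Strict Implicit.
Unset Printing Implicit Defensive.

Local Open Scope classical_set_scope.
Local Open Scope ring_scope.

(** Each of the four matrices has entries of the form
    [y ((al i + be j) %% N)], with [al], [be] injective into [0, N[, where
    [N = n] for the three circulant types and [N = 2 n] for the Hankel type, and
    where [y m] is the input variable of index [input_index p n m]. Expanding
    [y] in the discrete Fourier basis of Z/NZ and splitting the cosine and sine
    of [al i + be j] by the addition formulas turns the bilinear form of the
    matrix into a sum over the [N] frequencies of products of Fourier
    coefficients of [u], [v] and [y]; Parseval for [u] and [v] then bounds it by
    the largest cosine or sine coefficient of [y] ([bilinear_form_le]). Hence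
    the spectral norm is at most twice the largest of the 2N coefficients of [y]
    ([spectral_norm_fourier]), for every value of the input.

    Each coefficient of [y] is a linear combination of independent standard
    normal variables. An input variable is used at most twice among
    [y 0, ..., y (N - 1)], so the weights are at most 2 and the variance is at
    most [12 n] ([sum_gather_sqr_le]). The moment generating function and the
    Chernoff bound ([gaussian_sum_norm_tail]) show that a given coefficient
    exceeds [12 sqrt(n log n)] with probability at most [2 n^-6]. There are at
    most [4 n] coefficients, so the probabilities that one of them is too large
    are summable ([large_coef_le]), and Borel-Cantelli gives the theorem with
    [C = 24].

    The moment generating function of a sum of independent variables rests on
    the product rule for expectations ([expectation_prod_indep]), which is
    derived here from independence of events by exchanging indicators for
    nonnegative functions one variable at a time. *)

(** * Densities and products of independent variables *)

Section Density.
Local Open Scope ereal_scope.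
Context d d' (T : measurableType d) (T' : measurableType d') (R : realType).
Variables (mu : {measure set T -> \bar R}) (nu : {measure set T' -> \bar R}).
Variables (Z : T -> T') (G : T -> R) (c : R).
Hypothesis mZ : measurable_fun setT Z.
Hypothesis mG : measurable_fun setT G.
Hypothesis G0 : forall x, (0 <= G x)%R.
Hypothesis nuE : forall B, measurable B ->
  c%:E * nu B = \int[mu]_x (\1_B (Z x) * G x)%:E.

Import HBNNSimple.

Let sfun_density (h : {nnsfun T' >-> R}) :
  c%:E * \int[nu]_y (h y)%:E = \int[mu]_x (h (Z x) * G x)%:E.
Proof.
have indicE (r : R) : measurable_fun setT (fun y => \1_(h @^-1` [set r]) y : R).
  exact: measurable_indic.
have ms r : measurable_fun [set: T']
    (fun y : T' => (r * \1_(h @^-1` [set r]) y)%:E).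
  exact/measurable_EFinP/measurable_funM.
transitivity (c%:E * \sum_(r \in range h) (r%:E * nu (h @^-1` [set r]))).
  congr (_ * _); under eq_integral do rewrite fimfunE -fsumEFin//.
  rewrite ge0_integral_fsum//; last by move=> r y _; exact: nnfun_muleindic_ge0.
  apply: eq_fsbigr => r _; rewrite integralZl_indic_nnsfun//.
  by rewrite integral_indic// setIT.
rewrite ge0_mule_fsumr; last first.
  move=> r; apply: (mulemu_ge0 (fun r => h @^-1` [set r])) => r0.
  by rewrite preimage_nnfun0.
under [RHS]eq_integral do rewrite fimfunE mulrC mulr_fsumr -fsumEFin//.
rewrite ge0_integral_fsum//.
- apply: eq_fsbigr => r rh.
  have r0 : (0 <= r)%R by move: rh; rewrite inE => -[y _ <-].
  rewrite muleCA nuE// -ge0_integralZl//.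
  + by apply: eq_integral => x _; rewrite -EFinM mulrA [in RHS]mulrC.
  + by apply/measurable_EFinP/measurable_funM => //; exact: measurableT_comp.
  + by move=> x _; rewrite lee_fin mulr_ge0.
- move=> r; apply/measurable_EFinP/measurable_funM => //.
  by apply: measurable_funM => //; exact: measurableT_comp.
- move=> r x _; rewrite EFinM mule_ge0 ?lee_fin//.
  exact: nnfun_muleindic_ge0.
Qed.

(** The hypothesis says that the image under [Z] of the measure with density [G]
    is [c * nu], tested on indicators only; simple functions and monotone
    convergence extend it to all nonnegative functions. It serves twice: with
    [Z] the identity to integrate against a law given by a density, and with [G]
    a product of functions of other variables to replace one indicator in the
    product rule. *)
Lemma integral_density (f : T' -> \bar R) :
    measurable_fun setT f -> (forall y, 0 <= f y) ->
  c%:E * \int[nu]_y f y = \int[mu]_x (f (Z x) * (G x)%:E).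
Proof.
move=> mf f0.
pose h := nnsfun_approx measurableT mf.
have ch y : EFin \o h^~ y @ \oo --> f y by exact: cvg_nnsfun_approx.
have nd y m n : (m <= n)%N -> (h m y <= h n y)%R.
  by move=> mn; exact/lefP/nd_nnsfun_approx.
have mh n : measurable_fun setT (h n) by [].
have h1 : \int[nu]_y (EFin \o h n) y @[n --> \oo] --> \int[nu]_y f y.
  under [X in _ --> X]eq_integral do rewrite -(cvg_lim _ (ch _))//.
  apply: (@cvg_monotone_convergence _ _ _ nu _ measurableT
    (fun n y => (h n y)%:E)) => //.
  - by move=> n; exact/measurable_EFinP.
  - by move=> n x _; rewrite lee_fin.
  - by move=> x _ m n mn; rewrite lee_fin nd.
have h2 : \int[mu]_x (h n (Z x) * G x)%:E @[n --> \oo] -->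
    \int[mu]_x (f (Z x) * (G x)%:E).
  have cG x : (h n (Z x) * G x)%:E @[n --> \oo] --> f (Z x) * (G x)%:E.
    under eq_cvg do rewrite EFinM.
    by apply: cvgeZr => //; exact: ch.
  under [X in _ --> X]eq_integral do rewrite -(cvg_lim _ (cG _))//.
  apply: (@cvg_monotone_convergence _ _ _ mu _ measurableT
    (fun n x => (h n (Z x) * G x)%:E)) => //.
  - move=> n; apply/measurable_EFinP/measurable_funM => //.
    exact: measurableT_comp.
  - by move=> n x _; rewrite lee_fin mulr_ge0.
  - by move=> x _ m n mn; rewrite lee_fin ler_wpM2r ?nd.
have h3 : c%:E * \int[nu]_y (EFin \o h n) y @[n --> \oo] -->
    c%:E * \int[nu]_y f y by exact: cvgeZl.
have h2' : c%:E * \int[nu]_y (EFin \o h n) y @[n --> \oo] -->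
    \int[mu]_x (f (Z x) * (G x)%:E) by under eq_cvg do rewrite sfun_density.
by rewrite -(cvg_lim _ h3)// (cvg_lim _ h2').
Qed.

End Density.

Section Independence.
Local Open Scope ereal_scope.
Context d d' (T : measurableType d) (T' : measurableType d') (R : realType).
Context (I : choiceType) (P : probability T R) (X : I -> {RV P >-> T'}).
Hypothesis indX : mutually_independent X.

(** When every [g i] is an indicator this is the definition of independence. The
    list [s] in the proof contains the indices at which [g] is allowed to be
    arbitrary. Adding an index [k] to [s] amounts to passing from indicators to
    arbitrary functions in the factor [k] while the others are fixed, which is
    [integral_density] for the law of [X k]. Finiteness of the integrals keeps
    the constant [c] of that lemma real. *)
Lemma expectation_prod_indep (J : {fset I}) (g : I -> T' -> R) :
    (forall i, measurable_fun setT (g i)) -> (forall i y, 0 <= g i y)%R ->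
    (forall i, \int[P]_x (g i (X i x))%:E \is a fin_num) ->
  \int[P]_x (\prod_(i <- J) g i (X i x))%:E =
  \prod_(i <- J) \int[P]_x (g i (X i x))%:E.
Proof.
suff gen (s : seq I) : forall g : I -> T' -> R,
    (forall i, measurable_fun setT (g i)) -> (forall i y, 0 <= g i y)%R ->
    (forall i, \int[P]_x (g i (X i x))%:E \is a fin_num) ->
    (forall i, i \in (J : seq I) -> i \notin s ->
       exists2 B, measurable B & g i = \1_B) ->
    \int[P]_x (\prod_(i <- J) g i (X i x))%:E =
    \prod_(i <- J) \int[P]_x (g i (X i x))%:E.
  by move=> mg g0 gfin; apply: (gen J) => // i ->.
elim: s => [|k s IH] {}g mg g0 gfin gind.
  have /choice[B BE] i : exists B, measurable B /\
      (i \in (J : seq I) -> g i = \1_B).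
    case: (boolP (i \in (J : seq I))) => iJ; last by exists set0.
    by have [B mB gB] := gind i iJ isT; exists B.
  have mB i : measurable (B i) := (BE i).1.
  have mXB i : measurable (X i @^-1` B i).
    by rewrite -[X in measurable X]setTI; exact: measurable_funPT.
  transitivity (\int[P]_x (\1_(\bigcap_(i in [set` J]) (X i @^-1` B i)) x)%:E).
    apply: eq_integral => x _; congr (_%:E).
    rewrite indicE; case: (boolP (x \in _)).
      rewrite inE => xB; rewrite big_seq big1// => i iJ.
      by rewrite (BE i).2// indicE mem_set//; exact: xB.
    rewrite notin_setE => xB.
    have [i iJ nB] : exists2 i, i \in J & ~ B i (X i x).
      apply: contrapT => /forall2NP H; apply: xB => i /= iJ.
      by have [//|/contrapT] := H i.
    rewrite (big_rem i)//= (BE i).2// indicE memNset ?mul0r//.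
  rewrite integral_indic// ?setIT; last first.
    by apply: fin_bigcap_measurable => //; exact: finite_fset.
  apply: (etrans (indX J mB)); rewrite [LHS]big_seq [RHS]big_seq.
  apply: eq_bigr => i iJ; rewrite (BE i).2//.
  rewrite (_ : (fun x => _) = fun x => (\1_(X i @^-1` B i) x)%:E)//.
  by rewrite integral_indic// setIT.
case: (boolP (k \in (J : seq I))) => kJ; last first.
  apply: IH => // i iJ iNs; apply: gind => //.
  by rewrite inE negb_or iNs andbT; apply: contraNneq kJ => <-.
have uJ : uniq J by exact: fset_uniq.
pose c := \prod_(i <- J | i != k) \int[P]_x (g i (X i x))%:E.
pose G x := (\prod_(i <- J | i != k) g i (X i x))%R.
have cfin : c \is a fin_num.
  by rewrite /c; elim/big_ind : _ => // a b; exact: fin_numM.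
have mG : measurable_fun setT G.
  rewrite /G; under eq_fun do rewrite -big_filter.
  apply: measurable_prod => i _; exact: measurableT_comp.
rewrite (bigD1_seq k)//=.
have := @integral_density _ _ _ _ R P (distribution P (X k)) (X k) G (fine c)
  (measurable_funPT _) mG _ _ (EFin \o g k).
rewrite ge0_integral_distribution//; last 2 first.
- exact/measurable_EFinP.
- by move=> y; rewrite lee_fin.
rewrite fineK// muleC => -> //=; last 4 first.
- by move=> x; exact: prodr_ge0.
- move=> B mB.
  pose g' i := if i == k then \1_B else g i.
  have g'k i : i != k -> g' i = g i by rewrite /g' => /negbTE ->.
  have mXB : measurable (X k @^-1` B).
    by rewrite -[X in measurable X]setTI; exact: measurable_funPT.
  have intB : \int[P]_x (\1_B (X k x))%:E = distribution P (X k) B.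
    rewrite (_ : (fun x => _) = fun x => (\1_(X k @^-1` B) x)%:E)//.
    by rewrite integral_indic// setIT.
  transitivity (\int[P]_x (\prod_(i <- J) g' i (X i x))%:E).
    rewrite IH.
    + rewrite (bigD1_seq k)//= /g' eqxx intB muleC; congr (_ * _).
      by apply: eq_bigr => i /g'k; rewrite /g' => ->.
    + move=> i; rewrite /g'; case: eqP => // _; exact: measurable_indic.
    + by move=> i y; rewrite /g'; case: eqP.
    + move=> i; rewrite /g'; case: eqP => // ->; rewrite intB.
      exact: fin_num_measure.
    + move=> i iJ iNs; rewrite /g'; case: eqP => [_|/eqP ik]; first by exists B.
      by apply: gind => //; rewrite inE negb_or ik.
  apply: eq_integral => x _; rewrite (bigD1_seq k)//= /g' eqxx; congr (_ * _)%:E.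
  by apply: eq_bigr => i /g'k; rewrite /g' => ->.
- exact/measurable_EFinP.
- by move=> y; rewrite lee_fin.
- by apply: eq_integral => x _; rewrite (bigD1_seq k).
Qed.

End Independence.

(** * Tails of Gaussian linear combinations *)

Section Gaussian.
Context (R : realType).

Context d (T : measurableType d) (P : probability T R).

(** Completing the square: [exp(t x)] times the density of N(0, 1) at [x] is
    [exp(t^2 / 2)] times the density of N(t, 1) at [x], which has integral 1. *)
Lemma standard_normal_mgf (Y : {RV P >-> R}) (t : R) : standard_normal Y ->
  (\int[P]_w (expR (t * Y w))%:E = (expR (t ^+ 2 / 2))%:E)%E.
Proof.
move=> hY.
have mexp : measurable_fun [set: R] (fun x => expR (t * x)).
  by apply: measurableT_comp => //; exact: measurable_funM.
transitivity (\int[distribution P Y]_x (expR (t * x))%:E)%E.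
  rewrite ge0_integral_distribution//; exact/measurable_EFinP.
have := @integral_density _ _ _ _ R lebesgue_measure (distribution P Y)
  id (normal_pdf 0 1) 1 _ (measurable_normal_pdf _ _)
  (normal_pdf_ge0 _ _) _ (fun x => (expR (t * x))%:E).
rewrite mul1e => ->.
- transitivity (\int[lebesgue_measure]_x
      ((expR (t ^+ 2 / 2))%:E * (normal_pdf t 1 x)%:E))%E.
    apply: eq_integral => x _; rewrite -!EFinM !normal_pdfE ?oner_neq0//.
    congr (_%:E); rewrite /normal_fun mulrCA [RHS]mulrCA -!expRD.
    by congr (_ * expR _); field.
  rewrite ge0_integralZl ?integral_normal_pdf ?mule1//.
  + by apply/measurable_EFinP; exact: measurable_normal_pdf.
  + by move=> x _; rewrite lee_fin normal_pdf_ge0.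
- exact: measurable_id.
- move=> B mB; rewrite mul1e; apply: (etrans (hY B mB)).
  rewrite /normal_prob /= [LHS]integral_mkcond.
  apply: eq_integral => x _; rewrite patchE/= indicE.
  by case: ifPn => _; rewrite ?mul1r ?mul0r.
- exact/measurable_EFinP.
- by move=> y; rewrite lee_fin expR_ge0.
Qed.

Variable X : nat -> {RV P >-> R}.
Hypothesis gX : gaussian_input X.

Lemma gaussian_sum_mgf (a : nat -> R) (L : nat) :
  (\int[P]_w (expR (\sum_(l < L) a l * X l w))%:E =
   (expR ((\sum_(l < L) a l ^+ 2) / 2))%:E)%E.
Proof.
case: gX => indX nX.
pose J := [fset l in iota 0 L]%fset.
have JL : perm_eq (J : seq nat) (index_iota 0 L).
  apply: uniq_perm; [exact: fset_uniq|exact: iota_uniq|].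
  by move=> l; rewrite in_fset/= /index_iota subn0.
pose g l (x : R) := expR (a l * x).
transitivity (\int[P]_w (\prod_(l <- J) g l (X l w))%:E)%E.
  by apply: eq_integral => w _; rewrite expR_sum (perm_big _ JL)/= big_mkord.
rewrite (@expectation_prod_indep _ _ _ _ R nat P X indX J g).
- rewrite (perm_big _ JL)/= big_mkord.
  transitivity (\prod_(l < L) (expR ((a l) ^+ 2 / 2))%:E)%E.
    by apply: eq_bigr => l _; exact: standard_normal_mgf.
  by rewrite prodEFin -expR_sum mulr_suml.
- by move=> i; apply: measurableT_comp => //; exact: measurable_funM.
- by move=> i y; exact: expR_ge0.
- by move=> i; rewrite (standard_normal_mgf _ (nX i)).
Qed.

Lemma measurable_gaussian_sum (a : nat -> R) (L : nat) :
  measurable_fun setT (fun w => \sum_(l < L) a l * X l w).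
Proof. by apply: measurable_sum => l; exact: measurable_funM. Qed.

(** The Chernoff bound at [s / v], where the exponent [t^2 v / 2 - t s] is
    minimal. *)
Lemma gaussian_sum_tail (a : nat -> R) (L : nat) (v s : R) :
  0 < v -> 0 < s -> \sum_(l < L) a l ^+ 2 <= v ->
  (P [set w | s <= \sum_(l < L) a l * X l w]%R <=
   (expR (- (s ^+ 2 / (2 * v))))%:E)%E.
Proof.
move=> v0 s0 av.
pose mS := isMeasurableFun.Build _ _ _ _ _ (measurable_gaussian_sum a L).
pose S : {RV P >-> R} := HB.pack (fun w => \sum_(l < L) a l * X l w) mS.
have sv : 0 < s / v by exact: divr_gt0.
apply: (le_trans (chernoff S s sv)).
have -> : 'M_P S (s / v) = (\int[P]_w
    (expR (\sum_(l < L) (s / v * a l) * X l w))%:E)%E.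
  rewrite /mmt_gen_fun unlock; apply: eq_integral => w _ /=.
  by congr (expR _)%:E; rewrite mulrC mulr_sumr; apply: eq_bigr => l _;
    rewrite mulrA.
rewrite (gaussian_sum_mgf (fun l => s / v * a l) L) -EFinM lee_fin -expRD ler_expR.
under eq_bigr do rewrite exprMn; rewrite -mulr_sumr.
have -> : - (s ^+ 2 / (2 * v)) = (s / v) ^+ 2 * v / 2 - s / v * s.
  by field; rewrite gt_eqF.
by rewrite lerD2r ler_pM2r// ler_pM2l// exprn_gt0.
Qed.

Let measurable_sum_ge (a : nat -> R) (L : nat) (s : R) :
  measurable [set w | s <= \sum_(l < L) a l * X l w].
Proof.
rewrite -[X in measurable X]setTI.
rewrite (_ : [set w | _] = (fun w => \sum_(l < L) a l * X l w) @^-1` `[s, +oo[).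
  by apply: (measurable_gaussian_sum a L).
by apply/seteqP; split => w /=; rewrite in_itv/= andbT.
Qed.

Let norm_geE (a : nat -> R) (L : nat) (s : R) :
  [set w | s <= `|\sum_(l < L) a l * X l w|] =
  [set w | s <= \sum_(l < L) a l * X l w] `|`
  [set w | s <= \sum_(l < L) - a l * X l w].
Proof.
apply/seteqP; split => w /=; under [X in _ \/ s <= X]eq_bigr do
  rewrite mulNr; rewrite sumrN ler_normr => /orP//.
Qed.

Lemma measurable_norm_sum_ge (a : nat -> R) (L : nat) (s : R) :
  measurable [set w | s <= `|\sum_(l < L) a l * X l w|].
Proof.
rewrite norm_geE; apply: measurableU; first exact: measurable_sum_ge.
exact: (measurable_sum_ge (fun l => - a l)).
Qed.

Lemma gaussian_sum_norm_tail (a : nat -> R) (L : nat) (v s : R) :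
  0 < v -> 0 < s -> \sum_(l < L) a l ^+ 2 <= v ->
  (P [set w | s <= `|\sum_(l < L) a l * X l w|]%R <=
   (2 * expR (- (s ^+ 2 / (2 * v))))%:E)%E.
Proof.
move=> v0 s0 av.
rewrite norm_geE.
apply: (le_trans (measureU2 _ _ _)).
- exact: measurable_sum_ge.
- exact: (measurable_sum_ge (fun l => - a l)).
rewrite mulr_natl mulr2n EFinD leeD ?gaussian_sum_tail//.
apply: (gaussian_sum_tail (a := fun l => - a l)) => //.
by under eq_bigr do rewrite sqrrN.
Qed.

End Gaussian.

(** * Real Fourier analysis on Z/NZ *)

Section Fourier.
Context (R : realType).

Definition phase (N k a : nat) : R := (pi *+ 2) * (k%:R * a%:R / N%:R).

Definition cos_coef N (y : nat -> R) k := \sum_(m < N) y m * cos (phase N k m).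
Definition sin_coef N (y : nat -> R) k := \sum_(m < N) y m * sin (phase N k m).

Lemma phaseD N k a b : phase N k (a + b) = phase N k a + phase N k b.
Proof. by rewrite /phase natrD -mulrDr -mulrDl -mulrDr. Qed.

Lemma phase_modn N k a : (0 < N)%N ->
  phase N k a = phase N k (a %% N) + (pi *+ 2) *+ (k * (a %/ N)).
Proof.
move=> N0; rewrite -[LHS]addr0 [in LHS](divn_eq a N) addnC phaseD addr0.
congr (_ + _); rewrite /phase -[RHS]mulr_natr !natrM; field.
by rewrite pnatr_eq0 -lt0n.
Qed.

Lemma cos_phase_modn N k a : (0 < N)%N ->
  cos (phase N k (a %% N)) = cos (phase N k a).
Proof. by move=> N0; rewrite [in RHS]phase_modn// (periodicn (@cosD2pi R)). Qed.

Lemma sin_phase_modn N k a : (0 < N)%N ->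
  sin (phase N k (a %% N)) = sin (phase N k a).
Proof. by move=> N0; rewrite [in RHS]phase_modn// (periodicn (@sinD2pi R)). Qed.

(** The vector with coordinates [\sum_k cos (k t)] and [\sum_k sin (k t)] is
    invariant under the rotation of angle [t], since shifting [k] by one only
    exchanges the equal terms [k = 0] and [k = N]; a nontrivial rotation has no
    fixed vector but 0. *)
Lemma sum_cos_eq0 N (t : R) : cos t != 1 -> cos (N%:R * t) = 1 ->
  \sum_(k < N) cos (k%:R * t) = 0.
Proof.
move=> t1 Nt1.
have Nt0 : sin (N%:R * t) = 0 by apply: cos1sin0; rewrite Nt1 normr1.
set S := \sum_(k < N) _; pose U := \sum_(k < N) sin (k%:R * t).
have shift (f : R -> R) : f (N%:R * t) = f 0 ->
    \sum_(k < N) f (k%:R * t + t) = \sum_(k < N) f (k%:R * t).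
  move=> fN; apply: (@addIr _ (f 0)).
  have -> : \sum_(k < N) f (k%:R * t) + f 0 = \sum_(k < N.+1) f (k%:R * t).
    by rewrite big_ord_recr/= fN.
  rewrite big_ord_recl/= mul0r addrC; congr (_ + _).
  by apply: eq_bigr => k _; rewrite /bump/= add1n -natr1 mulrDl mul1r.
have Sc : cos t * S - sin t * U = S.
  rewrite -[RHS](shift cos) ?Nt1 ?cos0// !mulr_sumr -sumrB.
  by apply: eq_bigr => k _; rewrite cosD [cos t * _]mulrC [sin t * _]mulrC.
have Us : sin t * S + cos t * U = U.
  rewrite -[RHS](shift sin) ?Nt0 ?sin0// !mulr_sumr -big_split/=.
  by apply: eq_bigr => k _; rewrite sinD addrC [cos t * _]mulrC [sin t * _]mulrC.
have c2 := cos2Dsin2 t.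
have /eqP : (1 - cos t) * S = 0.
  have : (2 * (1 - cos t)) * S = 0.
    (* The determinant of the rotation minus the identity. *)
    have -> : 2 * (1 - cos t) = (1 - cos t) ^+ 2 + sin t ^+ 2.
      by nra.
    transitivity ((1 - cos t) * ((1 - cos t) * S + sin t * U) -
                  sin t * ((1 - cos t) * U - sin t * S)); first by ring.
    have -> : (1 - cos t) * S + sin t * U = 0 by lra.
    have -> : (1 - cos t) * U - sin t * S = 0 by lra.
    by rewrite !mulr0 subrr.
  lra.
by rewrite mulf_eq0 subr_eq0 eq_sym (negbTE t1)/= => /eqP.
Qed.

Lemma phase_orthogonal N a b : (a < N)%N -> (b < N)%N ->
  \sum_(k < N) cos (phase N k a - phase N k b) = (a == b)%:R * N%:R.
Proof.
wlog ab : a b / (b <= a)%N => [H aN bN|aN bN].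
  case: (leqP b a) => [/H->//|/ltnW /H H'].
  rewrite eq_sym -H'//; apply: eq_bigr => k _.
  by rewrite -[in LHS]cosN opprB.
case: eqP => [<-|/eqP nab].
  under eq_bigr do rewrite subrr cos0.
  by rewrite sumr_const card_ord mul1r.
have N0 : (0 < N)%N by apply: leq_ltn_trans aN.
have N0R : (N%:R : R) != 0 by rewrite pnatr_eq0 -lt0n.
have {}ab : (b < a)%N by rewrite ltn_neqAle eq_sym nab.
pose h : R := pi * ((a - b)%N%:R / N%:R).
rewrite mul0r -[RHS](@sum_cos_eq0 N (h *+ 2)).
- apply: eq_bigr => k _; congr cos.
  by rewrite /phase /h natrB ?(ltnW ab)//; field.
- rewrite cos_mulr2n cos2sin2.
  have h0 : 0 < sin h.
    apply: sin_gt0_pi; rewrite /h mulr_gt0 ?pi_gt0 ?divr_gt0 ?ltr0n ?subn_gt0//=.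
    rewrite gtr_pMr ?pi_gt0// ltr_pdivrMr ?ltr0n// mul1r ltr_nat.
    by rewrite (leq_ltn_trans (leq_subr _ _)).
  by apply/eqP => H; nra.
- have -> : N%:R * (h *+ 2) = 0 + (pi *+ 2) *+ (a - b).
    by rewrite /h add0r -[RHS]mulr_natr; field.
  by rewrite (periodicn (@cosD2pi R)) cos0.
Qed.

Lemma fourier_inversion N (y : nat -> R) m : (m < N)%N ->
  N%:R * y m = \sum_(k < N) (cos_coef N y k * cos (phase N k m) +
                             sin_coef N y k * sin (phase N k m)).
Proof.
move=> mN.
transitivity (\sum_(l < N) y l * \sum_(k < N) cos (phase N k l - phase N k m)).
  rewrite (bigD1 (Ordinal mN))//= phase_orthogonal// eqxx mul1r mulrC.
  rewrite big1 ?addr0// => l /eqP lm; rewrite phase_orthogonal//.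
  case: eqP => [lm'|]; last by rewrite mul0r mulr0.
  by case: lm; apply/val_inj.
under eq_bigr do rewrite mulr_sumr.
rewrite exchange_big/=; apply: eq_bigr => k _.
rewrite /cos_coef /sin_coef !mulr_suml -big_split/=; apply: eq_bigr => l _.
by rewrite cosB; ring.
Qed.

Lemma parseval N (I : finType) (al : I -> nat) (u : I -> R) :
  injective al -> (forall i, al i < N)%N ->
  \sum_(k < N) ((\sum_i u i * cos (phase N k (al i))) ^+ 2 +
                (\sum_i u i * sin (phase N k (al i))) ^+ 2) =
  N%:R * \sum_i u i ^+ 2.
Proof.
move=> inj_al alN.
transitivity (\sum_i \sum_j u i * u j *
    \sum_(k < N) cos (phase N k (al i) - phase N k (al j))).
  under [RHS]eq_bigr do under eq_bigr do rewrite mulr_sumr.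
  under [RHS]eq_bigr do rewrite exchange_big/=.
  rewrite [RHS]exchange_big/=; apply: eq_bigr => k _.
  rewrite !expr2 !mulr_suml -big_split/=; apply: eq_bigr => i _.
  rewrite !mulr_sumr -big_split/=; apply: eq_bigr => j _.
  by rewrite cosB; ring.
rewrite mulr_sumr; apply: eq_bigr => i _.
rewrite (bigD1 i)//= phase_orthogonal// eqxx mul1r.
rewrite [X in _ + X]big1 ?addr0 => [|j ji]; first by rewrite expr2 mulrC.
by rewrite phase_orthogonal// (inj_eq inj_al) eq_sym (negbTE ji) mul0r mulr0.
Qed.

(** Both factors of the addition formulas are Fourier coefficients of [u] and
    [v], so at each frequency the arithmetic-geometric inequality bounds the
    contribution by [M] times the squared moduli of these coefficients, and
    Parseval sums them up. The bound is not homogeneous in [u] and [v]: scaling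
    them recovers the Cauchy-Schwarz form. *)
Lemma bilinear_form_le n N (al be : 'I_n -> nat) (y : nat -> R) (M : R)
    (u v : 'I_n -> R) :
  (0 < N)%N -> injective al -> injective be ->
  (forall i, al i < N)%N -> (forall i, be i < N)%N ->
  (forall k, (k < N)%N -> `|cos_coef N y k| <= M) ->
  (forall k, (k < N)%N -> `|sin_coef N y k| <= M) ->
  \sum_i \sum_j u i * v j * y ((al i + be j) %% N)%N <=
    M * (\sum_i u i ^+ 2 + \sum_j v j ^+ 2).
Proof.
move=> N0 inj_al inj_be alN beN cM sM.
have N0R : (0 : R) < N%:R by rewrite ltr0n.
rewrite -(ler_pM2l N0R).
pose Uc k := \sum_i u i * cos (phase N k (al i)).
pose Us k := \sum_i u i * sin (phase N k (al i)).
pose Vc k := \sum_i v i * cos (phase N k (be i)).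
pose Vs k := \sum_i v i * sin (phase N k (be i)).
have -> : N%:R * \sum_i \sum_j u i * v j * y ((al i + be j) %% N)%N =
    \sum_(k < N) (cos_coef N y k * (Uc k * Vc k - Us k * Vs k) +
                  sin_coef N y k * (Us k * Vc k + Uc k * Vs k)).
  transitivity (\sum_i \sum_j \sum_(k < N) u i * v j *
      (cos_coef N y k * cos (phase N k (al i + be j)) +
       sin_coef N y k * sin (phase N k (al i + be j)))).
    rewrite mulr_sumr; apply: eq_bigr => i _.
    rewrite mulr_sumr; apply: eq_bigr => j _.
    rewrite mulrCA fourier_inversion ?ltn_pmod// mulr_sumr.
    by apply: eq_bigr => k _; rewrite cos_phase_modn// sin_phase_modn.
  under eq_bigr do rewrite exchange_big/=.
  rewrite exchange_big/=; apply: eq_bigr => k _.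
  rewrite /Uc /Us /Vc /Vs !big_distrlr/= -sumrB -big_split/= !mulr_sumr.
  rewrite -big_split/=; apply: eq_bigr => i _.
  rewrite -sumrB -big_split/= !mulr_sumr -big_split/=.
  by apply: eq_bigr => j _; rewrite phaseD cosD sinD; ring.
rewrite mulrCA mulrDr -(parseval u inj_al alN) -(parseval v inj_be beN).
rewrite -big_split/= mulr_sumr; apply: ler_sum => k _.
rewrite -/(Uc k) -/(Us k) -/(Vc k) -/(Vs k).
have := cM k (ltn_ord k); have := sM k (ltn_ord k).
move: (cos_coef _ _ _) (sin_coef _ _ _) => p q.
rewrite !ler_norml => /andP[q1 q2] /andP[p1 p2].
move: (Uc k) (Us k) (Vc k) (Vs k) => a b c e.
(* [h] is [r * z <= `|r| * `|z|] with the bounds [M] and [B / 2] plugged in. *)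
have h (r z B : R) : - M <= r -> r <= M -> 2 * z <= B -> - (2 * z) <= B ->
    2 * (r * z) <= M * B by move=> *; nra.
pose B := a ^+ 2 + b ^+ 2 + c ^+ 2 + e ^+ 2.
have sq := (sqr_ge0 (a - c), sqr_ge0 (a + c), sqr_ge0 (b - e), sqr_ge0 (b + e),
  (sqr_ge0 (a - e), sqr_ge0 (a + e), sqr_ge0 (b - c), sqr_ge0 (b + c))).
have Hp : 2 * (p * (a * c - b * e)) <= M * B.
  by apply: h => //; rewrite /B; case: sq => -[[[+ +] +] +] _; lra.
have Hq : 2 * (q * (b * c + a * e)) <= M * B.
  by apply: h => //; rewrite /B; case: sq => _ [[[+ +] +] +]; lra.
by move: Hp Hq; rewrite /B; lra.
Qed.

Lemma spectral_norm_le m n (A : 'M[R]_(m, n)) (K : R) :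
  (forall v, euclidean_norm v <= 1 -> euclidean_norm (A *m v) <= K) ->
  spectral_norm A <= K.
Proof.
move=> AK; apply: ge_sup => [|_ [v /= v1 <-]]; last exact: AK.
exists (euclidean_norm (A *m 0)), 0 => //=.
by rewrite /euclidean_norm big1 ?sqrtr0// => i _; rewrite mxE expr0n.
Qed.

(** Applying [bilinear_form_le] to [v] and to [u = A v / (2 M)], the scaling
    for which [`|A v|^2] appears on both sides with half the weight on the
    right, gives [`|A v| <= 2 M] when [`|v| <= 1]. *)
Lemma spectral_norm_fourier n N (al be : 'I_n -> nat) (y : nat -> R) (M : R)
    (A : 'M[R]_n) :
  (0 < N)%N -> injective al -> injective be ->
  (forall i, al i < N)%N -> (forall i, be i < N)%N -> 0 < M ->
  (forall k, (k < N)%N -> `|cos_coef N y k| <= M) ->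
  (forall k, (k < N)%N -> `|sin_coef N y k| <= M) ->
  (forall i j, A i j = y ((al i + be j) %% N)%N) ->
  spectral_norm A <= 2 * M.
Proof.
move=> N0 inj_al inj_be alN beN M0 cM sM AE; apply: spectral_norm_le => v v1.
have {}v1 : \sum_i v i 0 ^+ 2 <= 1.
  have v0 : 0 <= \sum_i v i 0 ^+ 2 by apply: sumr_ge0 => i _; exact: sqr_ge0.
  rewrite -[leLHS]sqr_sqrtr// expr_le1//; exact: sqrtr_ge0.
pose w := A *m v.
pose W := \sum_i w i 0 ^+ 2.
have H := @bilinear_form_le n N al be y M (fun i => (2 * M)^-1 * w i 0)
  (fun j => v j 0) N0 inj_al inj_be alN beN cM sM.
have {H} : (2 * M)^-1 * W <= M * ((2 * M)^-1 ^+ 2 * W + \sum_i v i 0 ^+ 2).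
  apply: le_trans (le_trans H _).
    rewrite /W mulr_sumr; apply: ler_sum => i _.
    rewrite expr2 mulrA [X in _ * X](_ : _ = \sum_j A i j * v j 0) ?mxE//.
    rewrite mulr_sumr; apply: ler_sum => j _.
    by rewrite AE le_eqVlt; apply/orP; left; apply/eqP; ring.
  by rewrite /W [in leRHS]mulr_sumr; under eq_bigr do rewrite exprMn.
have -> : M * ((2 * M)^-1 ^+ 2 * W + \sum_i v i 0 ^+ 2) =
    (2 * M)^-1 * (W / 2) + M * \sum_i v i 0 ^+ 2 by field; rewrite gt_eqF.
move=> WM; rewrite /euclidean_norm -/w -/W.
have -> : 2 * M = Num.sqrt ((2 * M) ^+ 2).
  by rewrite sqrtr_sqr gtr0_norm ?mulr_gt0.
apply: ler_wsqrtr.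
have {}WM : (2 * M)^-1 * (W / 2) <= M by nra.
by move: WM; rewrite mulrC ler_pdivrMr ?mulr_gt0//; nra.
Qed.

End Fourier.

(** * The four patterns as matrices indexed by Z/NZ *)

Section Patterns.

(** The index [i + j - 1] of a Hankel matrix takes [2 n - 1] values: modulo
    [2 n] it does not wrap around. *)
Definition period (p : pattern) (n : nat) : nat :=
  if p is Hankel then n.*2 else n.

(** Residues are shifted by one, so that the representatives [m + 1] run over
    1, ..., N, which is the reverse circulant convention when [N = n]. *)
Definition input_index (p : pattern) (n m : nat) : nat :=
  match p with
  | Circulant => m.+1 %% n
  | SymCirculant => minn m.+1 (n - m.+1)
  | RevCirculant | Hankel => m.+1
  end.

(** The circulant types depend on [j - i], which is [row_shift p n i + j + 1]
    modulo [n]. *)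
Definition row_shift (p : pattern) (n i : nat) : nat :=
  if p is (Circulant | SymCirculant) then n.-1 - i else i.

Let diff_mod n i j : (i < n)%N -> (j < n)%N ->
  ((n.-1 - i + j) %% n)%N =
    if (i < j)%N then (j - i).-1 else (n.-1 - (i - j))%N.
Proof.
move=> ilt jlt; case: ltnP => ij.
  by rewrite (_ : n.-1 - i + j = n + (j - i).-1)%N ?modnDl ?modn_small; lia.
by rewrite modn_small; lia.
Qed.

Lemma link_input_index p n i j : (i < n)%N -> (j < n)%N ->
  link p n i.+1 j.+1 =
    input_index p n ((row_shift p n i + j) %% period p n).
Proof.
move=> ilt jlt; case: p => /=.
- rewrite diff_mod//; case: ltnP => ij.
    rewrite prednK ?subn_gt0// modn_small; last by lia.
    rewrite (_ : j.+1%:Z - i.+1%:Z = (j - i)%N%:Z)%R; last by lia.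
    by rewrite modz_nat modn_small; lia.
  have [->|ne] := eqVneq i j.
    by rewrite subrr mod0z subnn subn0 prednK ?modnn//; lia.
  rewrite [RHS]modn_small; last by lia.
  rewrite -modzDl.
  rewrite (_ : n%:Z + (j.+1%:Z - i.+1%:Z) = (n - (i - j))%N%:Z)%R; last by lia.
  by rewrite modz_nat modn_small; lia.
- rewrite diff_mod//; case: ltnP => ij; lia.
- rewrite (_ : (i.+1 + j.+1 - 1 = (i + j).+1)%N); last by lia.
  have [lt|ge] := ltnP (i + j).+1 n.
    by rewrite !modn_small//=; lia.
  have [E|ne] := eqVneq (i + j).+1 n.
    by rewrite E modnn eqxx modn_small; lia.
  have [k E] : exists k, (i + j = n + k)%N by exists (i + j - n)%N; lia.
  by rewrite E -addnS !modnDl !modn_small//=; lia.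
- by rewrite modn_small; lia.
Qed.

Lemma row_shift_lt p n i : (i < n)%N -> (row_shift p n i < period p n)%N.
Proof. by case: p => /=; lia. Qed.

Lemma row_shift_inj p n : injective (fun i : 'I_n => row_shift p n i).
Proof.
by move=> [i ilt] [j jlt] /= H; apply/val_inj; move: H; case: p => /=; lia.
Qed.

Lemma period_le p n : (n <= period p n <= n.*2)%N.
Proof. by case: p => /=; lia. Qed.

Lemma input_index_lt p n m :
  (m < period p n)%N -> (input_index p n m < n.*2.+1)%N.
Proof.
by case: p => /= mn; lia.
Qed.

(** An input variable occurs at no more than two residues; two occur only for
    the symmetric circulant type. *)
Lemma input_index_fibre p n m : (m < period p n)%N ->
  (m.+1 == input_index p n m) || (m.+1 == n - input_index p n m)%N.
Proof.
case: p => /= mn; rewrite ?eqxx//; last by lia.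
have [lt|ge] := ltnP m.+1 n; first by rewrite modn_small ?eqxx.
by rewrite (_ : m.+1 = n) ?modnn ?subn0 ?eqxx ?orbT//; lia.
Qed.

Context (R : realType).

(** Coefficient of the input variable [l] in the combination of the
    [x (input_index p n m)] with coefficients [c m]; grouping equal variables
    is what makes the summands independent. *)
Definition gather (p : pattern) (n : nat) (c : nat -> R) (l : nat) : R :=
  \sum_(m < period p n | input_index p n m == l) c m.

Lemma sum_input_index p n (x c : nat -> R) :
  \sum_(m < period p n) x (input_index p n m) * c m =
  \sum_(l < n.*2.+1) gather p n c l * x l.
Proof.
under [RHS]eq_bigr do rewrite mulr_suml big_mkcond.
rewrite exchange_big/=; apply: eq_bigr => m _.
rewrite (bigD1 (Ordinal (input_index_lt (ltn_ord m))))//= eqxx.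
rewrite big1 ?addr0 1?mulrC// => l /eqP lm; case: eqP => // ml.
by case: lm; apply/val_inj.
Qed.

Lemma norm_gather_le p n (c : nat -> R) l :
  (forall m, `|c m| <= 1) -> `|gather p n c l| <= 2.
Proof.
move=> c1; apply: (le_trans (ler_norm_sum _ _ _)).
have one a : \sum_(m < period p n) ((m.+1 == a)%:R : R) <= 1.
  case: (leqP a (period p n)) => aN; last first.
    by rewrite big1 ?ler01// => m _; case: eqP => // E; have := ltn_ord m; lia.
  case: a aN => [|a] aN; first by rewrite big1 ?ler01.
  rewrite (bigD1 (Ordinal aN))//= eqxx big1 ?addr0// => m /eqP ma.
  by case: eqP => // -[E]; case: ma; apply/val_inj.
apply: (@le_trans _ _ (\sum_(m < period p n)
    ((m.+1 == l)%:R + (m.+1 == n - l)%N%:R))).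
  rewrite big_mkcond; apply: ler_sum => m _; case: eqP => [<-|_].
    apply: (le_trans (c1 m)).
    have := input_index_fibre (ltn_ord m).
    by case: eqP => _; case: eqP => _ //= _; rewrite ?addr0 ?add0r ?lerDl.
  by rewrite addr_ge0.
by rewrite big_split/= -[2]/(1 + 1) lerD.
Qed.

Lemma sum_gather_sqr_le p n (c : nat -> R) : (0 < n)%N ->
  (forall m, `|c m| <= 1) ->
  \sum_(l < n.*2.+1) gather p n c l ^+ 2 <= 12 * n%:R.
Proof.
move=> n0 c1; apply: (@le_trans _ _ (\sum_(l < n.*2.+1) 4)).
  apply: ler_sum => l _; rewrite -real_normK ?num_real//.
  have := norm_gather_le p n l c1; have := normr_ge0 (gather p n c l).
  by move: (`|_|) => z; nra.
by rewrite sumr_const card_ord -mulrnA -natrM ler_nat; lia.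
Qed.

Lemma spectral_norm_patterned p n (x : nat -> R) (M : R) : (0 < n)%N -> 0 < M ->
  (forall k, (k < period p n)%N ->
    `|cos_coef (period p n) (x \o input_index p n) k| <= M) ->
  (forall k, (k < period p n)%N ->
    `|sin_coef (period p n) (x \o input_index p n) k| <= M) ->
  spectral_norm (patterned_mx p x n) <= 2 * M.
Proof.
move=> n0 M0 cM sM; have /andP[nN _] := period_le p n.
apply: (@spectral_norm_fourier _ n (period p n)
  (fun i => row_shift p n i) (fun j => j) (x \o input_index p n)) => //.
- exact: leq_trans nN.
- exact: row_shift_inj.
- exact: val_inj.
- by move=> i; exact: row_shift_lt.
- by move=> j; apply: leq_trans nN.
- by move=> i j; rewrite mxE link_input_index.
Qed.

End Patterns.

(** * Almost sure bound *)

Section AlmostSure.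
Context (R : realType).

Lemma nneseries_telescope_lty (u : nat -> \bar R) : (forall n, 0 <= u n)%E ->
  (forall n, u n <= (n.+1%:R^-1 - n.+2%:R^-1)%:E)%E ->
  (\sum_(n <oo) u n < +oo)%E.
Proof.
move=> u0 ule; apply: (@le_lt_trans _ _ 1%E); last exact: ltry.
apply: lime_le; first by apply: is_cvg_nneseries => n _ _; exact: u0.
apply: nearW => m.
apply: (@le_trans _ _ (\sum_(0 <= n < m) (n.+1%:R^-1 - n.+2%:R^-1)%:E)%E).
  by apply: lee_sum => n _; exact: ule.
rewrite sumEFin lee_fin.
under eq_bigr do rewrite -opprB.
rewrite sumrN (telescope_sumr (fun n => n.+1%:R^-1))// opprB invr1.
by rewrite lerBlDr lerDl invr_ge0.
Qed.

Lemma limn_esup_le_near (u : nat -> \bar R) (C : \bar R) :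
  (\forall n \near \oo, u n <= C)%E -> (limn_esup u <= C)%E.
Proof.
move=> [N _ uC]; rewrite limn_esup_lim.
apply: lime_le; first exact: is_cvg_esups.
exists N => // m /= Nm; apply: ge_ereal_sup => _ [n /= mn <-].
by apply: uC => /=; exact: leq_trans mn.
Qed.

Context d (T : measurableType d) (P : probability T R).

Lemma borel_cantelli_near (F : (set T)^nat) :
  (forall n, measurable (F n)) -> (\sum_(n <oo) P (F n) < +oo)%E ->
  {ae P, forall w, \forall n \near \oo, ~ F n w}.
Proof.
move=> mF sF; exists (lim_sup_set F); split.
- apply: bigcapT_measurable => n; exact: bigcup_measurable.
- exact: lim_sup_set_cvg0.
- move=> w /= nw n _; apply: contrapT => nF; apply: nw.
  exists n => // j /= nj Fj; apply: nF; by exists j.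
Qed.

Variable X : nat -> {RV P >-> R}.
Hypothesis gX : gaussian_input X.
Variable p : pattern.

(** With variance at most [12 n], the factor 12 makes the Gaussian exponent
    [144 n log n / (24 n) = 6 log n]; any exponent above 2 would be summable
    over the at most [4 n] coefficients. *)
Definition threshold (n : nat) : R := 12 * Num.sqrt (n%:R * ln n%:R).

Lemma threshold_gt0 n : (1 < n)%N -> 0 < threshold n.
Proof.
move=> n1; rewrite mulr_gt0// sqrtr_gt0 mulr_gt0 ?ltr0n ?(ltnW n1)//.
by rewrite ln_gt0// ltr1n.
Qed.

(** The bad events: some Fourier coefficient of the periodic sequence built from
    the input reaches the threshold. *)
Definition large_sum n (c : nat -> R) : set T := [set w | threshold n <=
  `|\sum_(m < period p n) X (input_index p n m) w * c m|].

Definition large_freq n k : set T :=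
  large_sum n (fun m => cos (phase R (period p n) k m)) `|`
  large_sum n (fun m => sin (phase R (period p n) k m)).

Definition large_coef n : set T :=
  \big[setU/set0]_(k < period p n) large_freq n k.

Let large_sumE n c : large_sum n c = [set w | threshold n <=
  `|\sum_(l < n.*2.+1) gather p n c l * X l w|].
Proof.
by apply/seteqP; split => w; rewrite /large_sum/= (sum_input_index p n (X^~ w)).
Qed.

Lemma measurable_large_sum n c : measurable (large_sum n c).
Proof. by rewrite large_sumE; exact: measurable_norm_sum_ge. Qed.

Lemma measurable_large_freq n k : measurable (large_freq n k).
Proof. by apply: measurableU; exact: measurable_large_sum. Qed.

Lemma measurable_large_coef n : measurable (large_coef n).
Proof.
by apply: bigsetU_measurable => k _; exact: measurable_large_freq.
Qed.

Lemma large_sum_le n c : (1 < n)%N -> (forall m, `|c m| <= 1) ->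
  (P (large_sum n c) <= (2 * n%:R ^- 6)%:E)%E.
Proof.
move=> n1 c1; have n0 : (0 < n)%N by exact: ltnW.
have nR : (0 : R) < n%:R by rewrite ltr0n.
rewrite large_sumE.
apply: (le_trans (gaussian_sum_norm_tail gX (v := 12 * n%:R) _
  (threshold_gt0 n1) _)); first by rewrite mulr_gt0.
  exact: sum_gather_sqr_le.
have -> : threshold n ^+ 2 / (2 * (12 * n%:R)) = ln (n%:R : R) *+ 6.
  rewrite /threshold exprMn sqr_sqrtr; first by field; rewrite gt_eqF.
  by rewrite mulr_ge0 ?ln_ge0 ?ler1n ?ltW.
by rewrite expRN -lnXn// lnK// posrE exprn_gt0.
Qed.

Lemma large_coef_le n : (1 < n)%N ->
  (P (large_coef n) <= (8 * n%:R ^- 5)%:E)%E.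
Proof.
move=> n1; have nR : (0 : R) < n%:R by rewrite ltr0n ltnW.
apply: (le_trans (@Boole_inequality _ _ _ P (large_freq n) _ _)) => [k _|].
  exact: measurable_large_freq.
apply: (@le_trans _ _ (\sum_(k < period p n) (4 * n%:R ^- 6 : R)%:E)%E).
  apply: lee_sum => k _; apply: (le_trans (measureU2 _ _ _)).
  - exact: measurable_large_sum.
  - exact: measurable_large_sum.
  have -> : (4 * n%:R ^- 6 : R) = 2 * n%:R ^- 6 + 2 * n%:R ^- 6 by ring.
  rewrite EFinD leeD// large_sum_le// => m; [exact: cos_max|exact: sin_max].
rewrite sumEFin lee_fin sumr_const card_ord -[leLHS]mulr_natr.
have -> : 8 * n%:R ^- 5 = 4 * n%:R ^- 6 * (2 * n%:R) :> R.
  by field; rewrite gt_eqF.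
rewrite ler_pM2l ?mulr_gt0 ?invr_gt0 ?exprn_gt0// -natrM ler_nat.
by have /andP[_] := period_le p n; lia.
Qed.

(** The index is shifted by two because the threshold is positive only from
    [n = 2] on. *)
Lemma near_no_large_coef : {ae P, forall w, \forall n \near \oo,
  ~ large_coef n.+2 w}.
Proof.
apply: borel_cantelli_near => [n|]; first exact: measurable_large_coef.
apply: nneseries_telescope_lty => // n.
apply: (le_trans (large_coef_le _)) => //; rewrite lee_fin.
pose x : R := n.+1%:R.
have x1 : 1 <= x by rewrite ler1n.
have -> : n.+2%:R = x + 1 :> R by rewrite natr1.
rewrite -/x.
have x0 : 0 < x by lra.
have -> : x^-1 - (x + 1)^-1 = (x * (x + 1))^-1 by field; lra.
rewrite -[X in X * _]invrK -invfM lef_pV2 ?posrE ?mulr_gt0 ?exprn_gt0//; try lra.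
(* [8 / (x + 1)^5 <= 1 / (x + 1)^2 <= 1 / (x (x + 1))] since [x + 1 >= 2]. *)
have x3 : 8 <= (x + 1) ^+ 3.
  have -> : 8 = 2 ^+ 3 :> R by ring.
  by rewrite lerXn2r ?nnegrE//; lra.
rewrite (_ : 8^-1 * _ = (x + 1) ^+ 2 * (8^-1 * (x + 1) ^+ 3)); last by ring.
have : 1 <= 8^-1 * (x + 1) ^+ 3 by lra.
by nra.
Qed.

Lemma spectral_norm_no_large_coef n w : (1 < n)%N -> ~ large_coef n w ->
  spectral_norm (patterned_mx p (fun j => X j w) n) <= 2 * threshold n.
Proof.
move=> n1 nw; have sub k : (k < period p n)%N -> ~ large_freq n k w.
  move=> kN wk; apply: nw; rewrite /large_coef -(bigcup_mkord _ (large_freq n)).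
  by exists k.
apply: spectral_norm_patterned (ltnW n1) (threshold_gt0 n1) _ _ => k /sub H.
- by rewrite leNgt; apply/negP => lt; apply: H; left; exact: ltW.
- by rewrite leNgt; apply/negP => lt; apply: H; right; exact: ltW.
Qed.

End AlmostSure.

Theorem theorem7 (R : realType) :
  exists C : R, 0 < C /\
    forall (p : pattern) (d : measure_display) (T : measurableType d)
      (P : probability T R) (X : nat -> {RV P >-> R}),
      gaussian_input X ->
      {ae P, forall w : T,
        (limn_esup (fun n : nat =>
           (spectral_norm (patterned_mx p (fun j : nat => X j w) n)
              / Num.sqrt (n%:R * ln (n%:R)))%:E) <= C%:E)%E}.
Proof.
exists 24; split => // p d T P X gX.
apply: filterS (near_no_large_coef gX p) => w [N _ good].
apply: limn_esup_le_near; exists N.+2 => // n /= Nn; rewrite lee_fin.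
have n1 : (1 < n)%N by exact: leq_trans Nn.
have [m En] : exists m, n = m.+2 by exists n.-2; lia.
have := threshold_gt0 R n1; rewrite /threshold pmulr_rgt0// => s0.
rewrite ler_pdivrMr//.
have -> : 24 = 2 * 12 :> R by ring.
rewrite -mulrA; apply: spectral_norm_no_large_coef => //.
by rewrite En; apply: good => /=; lia.
Qed.
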